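(* Let $\mathcal X$ be the sample space with metric $c$, let $x_1,\dots,x_{n_1}\in\mathcal X$ and $y_1,\dots,y_{n_2}\in\mathcal X$, let $r_1,r_2\ge 0$, and let $\mathcal P_{\mu_0},\mathcal P_{\nu_0}$ be the Wasserstein balls of radii $r_1,r_2$ around the empirical distributions $\mu_0=\frac1{n_1}\sum_{i=1}^{n_1}\delta_{x_i}$ and $\nu_0=\frac1{n_2}\sum_{i=1}^{n_2}\delta_{y_i}$. Put $n=n_1+n_2$ and $(z_1,\dots,z_n)=(x_1,\dots,x_{n_1},y_1,\dots,y_{n_2})$. Then a pair of least favorable distributions, i.e. a solution of $$\min_{\mu\in\mathcal P_{\mu_0},\ \nu\in\mathcal P_{\nu_0}}\mathsf{KL}(\nu\|\mu),$$ can be found by solving the finite-dimensional convex program $$\begin{aligned} \min_{\substack{p_1,p_2\in\mathbb R_+^n\\ \Gamma_1,\Gamma_2\in\mathbb R_+^{n\times n}}}\quad & \sum_{l=1}^n p_2^l\log\frac{p_2^l}{p_1^l}\\ \text{subject to}\quad & \sum_{l=1}^n\sum_{m=1}^n\Gamma_{k,l,m}\,c(z_l,z_m)\le r_k,\quad k=1,2,\\ & \Gamma_1\mathbf 1_n=\mu_0,\qquad \Gamma_2\mathbf 1_n=\nu_0,\\ & \Gamma_1^{\top}\mathbf 1_n=p_1,\qquad \Gamma_2^{\top}\mathbf 1_n=p_2. \end{aligned}$$ That is, if $(p_1,p_2,\Gamma_1,\Gamma_2)$ is an optimal solution of this program, then the pair $\tilde\mu=\sum_{l=1}^n p_1^l\delta_{z_l}$,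 $\tilde\nu=\sum_{l=1}^n p_2^l\delta_{z_l}$ is a solution of the minimization of $\mathsf{KL}(\nu\|\mu)$ over $\mu\in\mathcal P_{\mu_0}$, $\nu\in\mathcal P_{\nu_0}$.
   Context: $\mathscr P(\mathcal X)$ is the set of all (Borel) probability distributions on $\mathcal X$; $\delta_x$ is the Dirac point mass at $x$. The Kullback-Leibler divergence is $\mathsf{KL}(\nu\|\mu)=\int\log\big(d\nu(x)/d\mu(x)\big)\,d\nu(x)$ (equal to $+\infty$ if $\nu$ is not absolutely continuous with respect to $\mu$; in the discrete objective, $0\log(0/p)=0$ for all $p\ge 0$ and $q\log(q/0)=+\infty$ for $q>0$). The Wasserstein distance of order 1 with respect to the metric $c:\mathcal X\times\mathcal X\to\mathbb R_+$ is $\mathsf W(P,Q)=\min_{\Gamma\in\Pi(P,Q)}\mathbb E_{(\omega,\omega')\sim\Gamma}[c(\omega,\omega')]$, where $\Pi(P,Q)$ is the set of joint distributions on $\mathcal X\times\mathcal X$ with marginals $P$ and $Q$. The ambiguity sets are $\mathcal P_{\mu_0}=\{\mu\in\mathscr P(\mathcal X):\mathsf W(\mu,\mu_0)\le r_1\}$ and $\mathcal P_{\nu_0}=\{\nu\in\mathscr P(\mathcal X):\mathsf W(\nu,\nu_0)\le r_2\}$. In the program, $\Gamma_{k,l,m}$ is the $(l,m)$ entry of the matrix $\Gamma_k$, $p_k^l$ is the $l$-th entry of $p_k$, $\mathbf 1_n$ is the all-ones column vector in $\mathbb R^n$, and $\mu_0,\nu_0$ are identified with the vectors of $\mathbb R^n$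 of their masses on $(z_1,\dots,z_n)$: $\mu_0$ has entries $1/n_1$ in positions $1,\dots,n_1$ and $0$ elsewhere; $\nu_0$ has entries $1/n_2$ in positions $n_1+1,\dots,n$ and $0$ elsewhere. *)

(* Defs.v *)
From HB Require Import structures.
From mathcomp Require Import all_boot all_order all_algebra.
From mathcomp Require Import all_classical all_reals all_analysis.
Set Implicit Arguments.
Unset Strict Implicit.
Unset Printing Implicit Defensive.
Import Order.TTheory GRing.Theory Num.Theory.
Import numFieldNormedType.Exports.

Local Open Scope classical_set_scope.
Local Open Scope ring_scope.

(* [g_sigma_algebraType] is a measurable type only over a pointed type. *)
#[short(type="pmetricType")]
HB.structure Definition PointedMetric (K : numDomainType) :=
  { M of Metric K M & isPointed M }.

Notation borelType T := (g_sigma_algebraType (@open T)).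

Section KullbackLeibler.
Context {d : measure_display} {T : measurableType d} {R : realType}.

(* [null_dominates mu nu] is absolute continuity of nu with respect to mu. The
   set where the density is 0 is nu-null, so [lne 0 = -oo] is harmless. *)
Definition KL (nu mu : probability T R) : \bar R :=
  if `[< nu `<< mu >] then
    (\int[nu]_t lne (Radon_Nikodym (charge_of_finite_measure nu) mu t))%E
  else +oo%E.

End KullbackLeibler.

Section Wasserstein.
Context {R : realType} {X : pmetricType R}.
Local Open Scope ereal_scope.

(* Joint laws live on the Borel sigma-algebra of the product topology, for which
   the metric is always measurable; it agrees with the product of the Borel
   sigma-algebras when X is separable. *)
Definition couplings (P Q : set (borelType X) -> \bar R) :
    set (probability (borelType (X * X)%type) R) :=
  [set G | (forall A : set (borelType X), measurable A ->
              G (A `*` [set: X]) = P A) /\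
           (forall B : set (borelType X), measurable B ->
              G ([set: X] `*` B) = Q B)].

Definition wasserstein (P Q : set (borelType X) -> \bar R) : \bar R :=
  ereal_inf [set \int[G]_w (mdist (w : X * X).1 (w : X * X).2)%:E
            | G in couplings P Q].

Definition wasserstein_ball (P0 : set (borelType X) -> \bar R) (r : R) :
    set (probability (borelType X) R) :=
  [set P | wasserstein P P0 <= r%:E].

Definition atomic n (p : 'cV[R]_n) (z : 'I_n -> X) :
    set (borelType X) -> \bar R :=
  fun A => \sum_(l < n) (p l ord0)%:E * \d_(z l : borelType X) A.

Definition empirical n (x : 'I_n -> X) : set (borelType X) -> \bar R :=
  fun A => (n%:R^-1)%:E * \sum_(i < n) \d_(x i : borelType X) A.

Definition least_favorable (Pmu Pnu : set (probability (borelType X) R))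
    (mu nu : probability (borelType X) R) : Prop :=
  [/\ Pmu mu, Pnu nu &
      forall mu' nu' : probability (borelType X) R,
        Pmu mu' -> Pnu nu' -> KL nu mu <= KL nu' mu'].

End Wasserstein.

Section Program.
Context {R : realType} {X : pmetricType R}.

Definition merge_samples n1 n2 (x : 'I_n1 -> X) (y : 'I_n2 -> X)
    (l : 'I_(n1 + n2)) : X :=
  match fintype.split l with inl i => x i | inr j => y j end.

Definition mu0_vec n1 n2 : 'cV[R]_(n1 + n2) :=
  col_mx (const_mx n1%:R^-1) (const_mx 0).

Definition nu0_vec n1 n2 : 'cV[R]_(n1 + n2) :=
  col_mx (const_mx 0) (const_mx n2%:R^-1).

Definition log_term (q p : R) : \bar R :=
  if q == 0 then 0%E else if p == 0 then +oo%E else (q * ln (q / p))%:E.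

Definition objective n (p1 p2 : 'cV[R]_n) : \bar R :=
  (\sum_(l < n) log_term (p2 l ord0) (p1 l ord0))%E.

Definition transport_constraints n (z : 'I_n -> X) (r : R) (p0 p : 'cV[R]_n)
    (G : 'M[R]_n) : Prop :=
  [/\ forall l, 0 <= p l ord0,
      forall l m, 0 <= G l m,
      \sum_(l < n) \sum_(m < n) G l m * mdist (z l) (z m) <= r,
      G *m const_mx 1 = p0 &
      G^T *m const_mx 1 = p].

Definition feasible n1 n2 (x : 'I_n1 -> X) (y : 'I_n2 -> X) (r1 r2 : R)
    (p1 p2 : 'cV[R]_(n1 + n2)) (G1 G2 : 'M[R]_(n1 + n2)) : Prop :=
  transport_constraints (merge_samples x y) r1 (mu0_vec n1 n2) p1 G1 /\
  transport_constraints (merge_samples x y) r2 (nu0_vec n1 n2) p2 G2.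

Definition optimal n1 n2 (x : 'I_n1 -> X) (y : 'I_n2 -> X) (r1 r2 : R)
    (p1 p2 : 'cV[R]_(n1 + n2)) (G1 G2 : 'M[R]_(n1 + n2)) : Prop :=
  feasible x y r1 r2 p1 p2 G1 G2 /\
  forall (q1 q2 : 'cV[R]_(n1 + n2)) (H1 H2 : 'M[R]_(n1 + n2)),
    feasible x y r1 r2 q1 q2 H1 H2 ->
    (objective p1 p2 <= objective q1 q2)%E.

End Program.

(* Main.v *)
Require Import Defs.
From HB Require Import structures.
From mathcomp Require Import all_boot all_order all_algebra.
From mathcomp Require Import all_classical all_reals all_analysis.
From mathcomp Require Import measurable_realfun.
From mathcomp Require Import ring lra.
Import Order.TTheory GRing.Theory Num.Theory.
Import numFieldNormedType.Exports.
Local Open Scope classical_set_scope.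
Local Open Scope ring_scope.

(** The finite program and the infinite-dimensional problem have the same
    value because the mass of any competitors [mu'] and [nu'] can be moved onto
    the sample points without increasing either transport cost or the
    divergence.

    A coupling of [mu'] with the empirical measure gives, for mass lying at a
    point [t], the law [a] of the sample from which it comes, and a coupling of
    [nu'] gives likewise a law [b] ([coupling_density]). Mass at [t] is relayed
    as follows: draw [l] from [a] and [m] from [b] independently, then go to
    [z m] with probability [d(t, z l) / (d(t, z l) + d(t, z m))], and to [z l]
    otherwise. Seen from the source [z l], the expected cost is at most
    [d(t, z l)], by the triangle inequality
    [d(z l, z m) <= d(t, z l) + d(t, z m)]; seen from the source [z m], it is at
    most [d(t, z m)], for the same reason ([relay_cost]). Hence neither cost
    increases. The random move from [t] does not depend on whether the mass
    belongs to [mu'] or to [nu'] ([relay_col]): the two are pushed forward by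
    one Markov kernel, and the divergence cannot increase either.

    The last point is used through the dual formula
    [q * ln (q / p) = sup_s ((s + 1) * q - expR s * p)], in the form of
    [KL_dual_le] on the side of the sample space and of [objective_le_dual] on
    the side of the program. The dual form states the bound on the objective by
    conditions that are closed in the transport plans. This is needed as the
    infimum in the definition of the Wasserstein distance need not be attained,
    so that the construction above only gives plans with an arbitrarily small
    excess of cost; the limit is taken by compactness ([ball_pair_plan]).

    In the other direction, a feasible point of the program gives two atomic
    measures that lie in the balls ([transport_wasserstein_ball]), and the
    divergence between them is at most the objective ([KL_finite_atomic_le]),
    possibly less when sample points coincide. *)

(** * Relaying mass through a pair of sites *)

Section Relay.
Context {R : realFieldType}.

(** The probability with which mass lying at distances [u] and [v] from two
    sites is sent to the second site. The value at [u = v = 0] is chosen so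
    that exchanging the two sites exchanges the two outcomes. *)
Definition relay_ratio (u v : R) : R :=
  if u + v == 0 then 2^-1 else u / (u + v).

Lemma relay_ratio_ge0 u v : 0 <= u -> 0 <= v -> 0 <= relay_ratio u v.
Proof.
move=> u0 v0; rewrite /relay_ratio; case: ifP => _; first by rewrite invr_ge0.
by rewrite divr_ge0// addr_ge0.
Qed.

Lemma relay_ratioD u v : relay_ratio u v + relay_ratio v u = 1.
Proof.
rewrite /relay_ratio (addrC v u); case: ifPn => [_|uv0].
  by rewrite [RHS](splitr 1) mul1r.
by rewrite -mulrDl divff.
Qed.

(** With [d <= u + v], the triangle inequality, the expected length of the hop
    between two sites at distance [d] is paid for by the distance [u] already
    covered from the first site and, by [relay_ratioD], symmetrically for [v]. *)
Lemma relay_ratio_dist u v d : 0 <= u -> 0 <= v -> 0 <= d -> d <= u + v ->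
  relay_ratio u v * d <= u.
Proof.
move=> u0 v0 d0 duv; rewrite /relay_ratio; case: ifPn => [/eqP uv0|uv0].
  have -> : d = 0 by apply/eqP; rewrite eq_le d0 andbT -uv0.
  by rewrite mulr0.
have uv_gt0 : 0 < u + v by rewrite lt_def uv0 addr_ge0.
by rewrite mulrAC ler_pdivrMr// ler_wpM2l.
Qed.

Context {n : nat}.
Implicit Types (e a b : 'I_n -> R) (c : 'I_n -> 'I_n -> R).

(** [e k] is the distance from a point to the site [k], and [a], [b] are two
    laws on the sites. Draw [l] from [a] and [m] from [b] independently, then
    move to [m] with probability [relay_ratio (e l) (e m)] and to [l] otherwise:
    [relay e a b] is the joint law of [l] and of the final site. *)
Definition relay e a b (l m : 'I_n) : R :=
  a l * b m * relay_ratio (e l) (e m) +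
  (l == m)%:R * (a l * \sum_k b k * relay_ratio (e k) (e l)).

Lemma relay_ge0 e a b l m : (forall k, 0 <= e k) -> (forall k, 0 <= a k) ->
  (forall k, 0 <= b k) -> 0 <= relay e a b l m.
Proof.
move=> e0 a0 b0; rewrite /relay addr_ge0// !mulr_ge0 ?relay_ratio_ge0//.
by apply: sumr_ge0 => k _; rewrite mulr_ge0// relay_ratio_ge0.
Qed.

Lemma relay_row e a b l : \sum_k b k = 1 -> \sum_m relay e a b l m = a l.
Proof.
move=> b1; rewrite big_split/= [X in _ + X](bigD1 l)//= eqxx mul1r.
rewrite [X in _ + (_ + X)]big1 ?addr0; last first.
  by move=> m /negPf; rewrite eq_sym => ->; rewrite mul0r.
under eq_bigr do rewrite -mulrA.
rewrite -mulr_sumr -mulrDr -big_split/=.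
under eq_bigr do rewrite -mulrDr relay_ratioD mulr1.
by rewrite b1 mulr1.
Qed.

(** The law of the final site does not see which of [a] and [b] is called the
    source. This is what lets the two distributions be transported by one and
    the same kernel while each is accounted for with its own sources. *)
Lemma relay_col e a b m :
  \sum_l relay e a b l m = \sum_l relay e b a l m.
Proof.
have colE f g : \sum_l relay e f g l m =
    g m * (\sum_l f l * relay_ratio (e l) (e m)) +
    f m * (\sum_l g l * relay_ratio (e l) (e m)).
  rewrite big_split/=; congr (_ + _).
    by rewrite mulr_sumr; apply: eq_bigr => l _; ring.
  rewrite (bigD1 m)//= eqxx mul1r [X in _ + X]big1 ?addr0// => l /negPf ->.
  by rewrite mul0r.
by rewrite !colE addrC.
Qed.

(** Staying at [l] costs nothing, and a hop is covered by [relay_ratio_dist]. *)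
Lemma relay_cost e a b c : \sum_k b k = 1 -> (forall k, 0 <= e k) ->
  (forall k, 0 <= a k) -> (forall k, 0 <= b k) ->
  (forall l m, 0 <= c l m) -> (forall l, c l l = 0) ->
  (forall l m, c l m <= e l + e m) ->
  \sum_l \sum_m relay e a b l m * c l m <= \sum_l a l * e l.
Proof.
move=> b1 e0 a0 b0 c0 cll ce; apply: ler_sum => l _.
rewrite -[a l]mulr1 -b1 mulr_sumr mulr_suml; apply: ler_sum => m _.
rewrite /relay mulrDl; have [->|_] := eqVneq l m.
  by rewrite cll !mulr0 addr0 !mulr_ge0.
by rewrite !mul0r addr0 -mulrA ler_wpM2l ?mulr_ge0// relay_ratio_dist.
Qed.

End Relay.

(** * A dual lower bound for the Kullback-Leibler divergence *)

Section KullbackLeibler.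
Context {d : measure_display} {T : measurableType d} {R : realType}.
Implicit Types mu nu : probability T R.
Local Open Scope ereal_scope.

Lemma unit_integrable (P : probability T R) (f : T -> R) :
  measurable_fun setT f -> (forall t, 0 <= f t <= 1)%R ->
  P.-integrable setT (EFin \o f).
Proof.
move=> mf f01; apply: (le_integrable measurableT _ _
  (finite_measure_integrable_cst P 1 measurableT));
  first exact/measurable_EFinP.
by move=> t _ /=; have /andP[f0 f1] := f01 t; rewrite lee_fin !ger0_norm.
Qed.

Lemma integrable_Rsum (P : {measure set T -> \bar R}) n (f : 'I_n -> T -> R) :
  (forall i, P.-integrable setT (EFin \o f i)) ->
  P.-integrable setT (EFin \o (fun t => \sum_i f i t)%R).
Proof.
move=> intf; rewrite (_ : _ \o _ = fun t => \sum_i (EFin \o f i) t).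
  exact: integrable_sum.
by apply/funext => t /=; rewrite sumEFin.
Qed.

Lemma Rintegral_sum (P : {measure set T -> \bar R}) n (f : 'I_n -> T -> R) :
  (forall i, P.-integrable setT (EFin \o f i)) ->
  (\int[P]_t (\sum_i f i t) = \sum_i \int[P]_t f i t)%R.
Proof.
move=> intf; rewrite /Rintegral.
under eq_integral do rewrite -sumEFin.
rewrite integral_sum// sum_fine// => i _.
exact: (integrable_fin_num measurableT (intf i)).
Qed.

(** Only the minorant has to be integrable: the integral of [f] may be [+oo]. *)
Lemma le_integral_minorant (P : {measure set T -> \bar R}) (g f : T -> \bar R) :
  P.-integrable setT g -> measurable_fun setT f -> (forall t, g t <= f t) ->
  \int[P]_t g t <= \int[P]_t f t.
Proof.
move=> intg mf gf; have mg := measurable_int _ intg.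
rewrite integralE [leRHS]integralE leeB//.
- apply: ge0_le_integral => //; [exact: measurable_funepos..|].
  by move=> t _; apply: (@funepos_le _ _ setT) => [u _|];
    rewrite ?inE; first exact: gf.
- apply: ge0_le_integral => //; [exact: measurable_funeneg..|].
  by move=> t _; apply: (@funeneg_le _ _ setT) => [u _|];
    rewrite ?inE; first exact: gf.
Qed.

(** A real-valued, everywhere nonnegative version of the density. On its zero
    set [ln] gives [0] instead of [-oo], which is harmless since that set is
    null for [nu]. *)
Lemma KL_density nu mu : nu `<< mu -> exists h : T -> R,
  [/\ measurable_fun setT h, forall t, (0 <= h t)%R,
      forall g : T -> \bar R, measurable_fun setT g -> (forall t, 0 <= g t) ->
        \int[nu]_t g t = \int[mu]_t (g t * (h t)%:E) &
      KL nu mu = \int[nu]_t (ln (h t))%:E].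
Proof.
move=> numu; pose f := Radon_Nikodym_SigmaFinite.f nu mu.
have f0 : forall t, 0 <= f t by exact: Radon_Nikodym_SigmaFinite.f_ge0.
have ff : forall t, f t \is a fin_num.
  exact: Radon_Nikodym_SigmaFinite.f_fin_num.
have mf : measurable_fun setT f.
  exact: measurable_int (Radon_Nikodym_SigmaFinite.f_integrable numu).
have fE : EFin \o (fine \o f) = f by apply/funext => t /=; rewrite fineK.
have mh : measurable_fun setT (fine \o f).
  by apply/measurable_EFinP; rewrite fE.
have cov (g : T -> \bar R) : measurable_fun setT g -> (forall t, 0 <= g t) ->
    \int[nu]_t g t = \int[mu]_t (g t * (fine (f t))%:E).
  move=> mg g0; rewrite -(Radon_Nikodym_SigmaFinite.change_of_variables numu)//.
  by apply: eq_integral => t _; rewrite fineK.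
exists (fine \o f); split=> // [t|]; first by rewrite /= fine_ge0.
rewrite /KL asboolT//; set F := Radon_Nikodym _ _.
have Ff t : F t \is a fin_num by exact: Radon_Nikodym_fin_num.
have mF : measurable_fun setT F.
  by apply: (measurable_int mu); exact: Radon_Nikodym_integrable.
have mfineF : measurable_fun setT (fine \o F).
  by apply/measurable_EFinP; rewrite (_ : _ \o _ = F)//;
    apply/funext => t /=; rewrite fineK.
have lneE : (fun t => lne (F t)) = (fun t =>
    if (0 < fine (F t))%R then (ln (fine (F t)))%:E else -oo).
  apply/funext => t; rewrite -{1}[F t]fineK//.
  case: ifPn => [F0|]; first exact: lne_EFin.
  by rewrite -leNgt => F0; rewrite le0_lneNy// lee_fin.
have ae_fF : ae_eq nu setT f F.
  apply: (null_dominates_ae_eq measurableT numu).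
  exact: ae_eq_Radon_Nikodym_SigmaFinite.
pose Z := [set t | fine (f t) = 0%R].
have mZ : measurable Z.
  have -> : Z = [set: T] `&` (fine \o f) @^-1` [set 0%R] by rewrite setTI.
  by apply: mh => //; exact: measurable_set1.
have Z0 : nu Z = 0.
  have := cov (fun t => (\1_Z t)%:E).
  rewrite integral_indic// setIT => ->; last 2 first.
  - exact/measurable_EFinP/measurable_indic.
  - by move=> t; rewrite lee_fin.
  apply: integral0_eq => t _; rewrite indicE.
  have [/set_mem tZ|_] := boolP (t \in Z); last by rewrite mul0e.
  by rewrite (_ : fine (f t) = 0%R)// mule0.
have ae_Z : {ae nu, forall t, fine (f t) != 0%R}.
  exists Z; split=> // t /= /negP; rewrite negbK => /eqP//.
apply: ae_eq_integral => //.
- rewrite lneE; apply: measurable_fun_ifT => //.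
    by apply: measurable_fun_ltr.
  exact/measurable_EFinP/measurableT_comp.
- exact/measurable_EFinP/measurableT_comp.
apply: filterS2 ae_fF ae_Z => t /= fFt ft0 _.
have {1}-> : F t = f t by rewrite fFt.
rewrite -{1}[f t]fineK// lne_EFin// lt_def ft0/=.
by rewrite fine_ge0.
Qed.

(** Data processing for the kernel [K], tested against a fixed [s]. Where the
    density is [h], each [s l + 1 - expR (s l - ln h)] is at most [ln h], by
    [expR_ge1Dx]; average these bounds over [l] with the weights [K l] and
    integrate over [nu]. *)
Lemma KL_dual_le n nu mu (K : 'I_n -> T -> R) (s : 'I_n -> R) :
  (forall l, measurable_fun setT (K l)) -> (forall l t, (0 <= K l t)%R) ->
  (forall t, (\sum_l K l t)%R = 1%R) ->
  (\sum_l ((s l + 1) * (\int[nu]_t K l t) -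
     expR (s l) * (\int[mu]_t K l t)))%R%:E <= KL nu mu.
Proof.
move=> mK K0 K1; have [numu|nnumu] := pselect (nu `<< mu); last first.
  by rewrite /KL asboolF// leey.
have [h [mh h0 cov ->]] := KL_density _ _ numu.
have K01 l t : (0 <= K l t <= 1)%R.
  by rewrite K0/= -(K1 t) (bigD1 l)//= lerDl sumr_ge0.
have mlnh : measurable_fun setT (fun t => ln (h t)) by exact: measurableT_comp.
pose w l t := (K l t * expR (s l - ln (h t)))%R.
have w0 l t : (0 <= w l t)%R by rewrite mulr_ge0// expR_ge0.
have mw l : measurable_fun setT (w l).
  by apply: measurable_funM => //; apply: measurableT_comp => //;
    exact: measurable_funB.
have intK (P : probability T R) l : P.-integrable setT (EFin \o K l).
  exact: unit_integrable.
(* an inequality only where [h t = 0] *)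
have wh l t : (w l t * h t <= expR (s l) * K l t)%R.
  have := h0 t; rewrite le_eqVlt => /predU1P[<-|ht].
    by rewrite mulr0 mulr_ge0// expR_ge0.
  by rewrite /w expRD expRN lnK ?posrE// -!mulrA mulVf ?gt_eqF// mulr1 mulrC.
have le_w l : \int[nu]_t (w l t)%:E <= (expR (s l) * \int[mu]_t K l t)%R%:E.
  rewrite cov; last 2 first.
  - exact/measurable_EFinP.
  - by move=> t; rewrite lee_fin.
  rewrite EFinM fineK; last exact: (integrable_fin_num measurableT (intK mu l)).
  rewrite -integralZl//; last exact: intK.
  apply: ge0_le_integral => //.
  - by move=> t _; rewrite -EFinM lee_fin mulr_ge0.
  - by apply/measurable_EFinP; exact: measurable_funM.
  - by apply/measurable_EFinP; exact: measurable_funM.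
  - by move=> t _; rewrite -!EFinM lee_fin.
have intw l : nu.-integrable setT (EFin \o w l).
  apply/integrableP; split; first exact/measurable_EFinP.
  under eq_integral do rewrite gee0_abs ?lee_fin//.
  exact: le_lt_trans (le_w l) (ltry _).
have le_Rw l : (\int[nu]_t w l t <= expR (s l) * \int[mu]_t K l t)%R.
  by rewrite -lee_fin fineK ?le_w//;
    exact: (integrable_fin_num measurableT (intw l)).
have intZK l : nu.-integrable setT (EFin \o (fun t => (s l + 1) * K l t)%R).
  exact: (integrableZl measurableT (s l + 1)%R (intK nu l)).
pose g l t := ((s l + 1) * K l t - w l t)%R.
have intg l : nu.-integrable setT (EFin \o g l).
  exact: (integrableB measurableT (intZK l) (intw l)).
apply: (@le_trans _ _ (\int[nu]_t (\sum_l g l t))%R%:E).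
  rewrite lee_fin Rintegral_sum//; apply: ler_sum => l _.
  rewrite RintegralB// RintegralZl//; last exact: intK.
  by rewrite lerD2l lerN2.
have intsg : nu.-integrable setT (EFin \o (fun t => \sum_l g l t)%R).
  exact: integrable_Rsum.
rewrite /Rintegral fineK; last first.
  exact: (integrable_fin_num measurableT intsg).
apply: le_integral_minorant => //; first exact/measurable_EFinP.
move=> t; rewrite lee_fin -[leRHS]mul1r -(K1 t) mulr_suml.
apply: ler_sum => l _.
rewrite /g /w mulrC -mulrBr ler_wpM2l//.
have := expR_ge1Dx (s l - ln (h t)); lra.
Qed.
(** The previous bound for the trivial kernel and [s = 0]. *)
Lemma KL_ge0 nu mu : 0 <= KL nu mu.
Proof.
have int1 (P : probability T R) : (\int[P]_t (cst 1 t) = 1)%R.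
  by rewrite Rintegral_cst// [X in fine X]probability_setT mulr1.
have := @KL_dual_le 1 nu mu (fun=> cst 1%R) (fun=> 0%R).
rewrite big_ord1 !int1 add0r expR0 subrr.
by apply=> // t; rewrite big_ord1.
Qed.

End KullbackLeibler.

(** * The dual form of the discrete objective *)

Section Dual.
Context {R : realType}.
Local Open Scope ereal_scope.

(** Convex duality: [log_term q p] is the supremum over [s] of
    [(s + 1) * q - expR s * p], attained at [s = ln (q / p)] when [p] and [q]
    are positive, and approached as [s] tends to an infinity when exactly one of
    them vanishes. *)
Lemma log_term_gt (q p t : R) : (0 <= q)%R -> (0 <= p)%R ->
  t%:E < log_term q p -> exists s, (t <= (s + 1) * q - expR s * p)%R.
Proof.
move=> q0 p0; rewrite /log_term; case: eqVneq => [->|qN0].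
  rewrite lte_fin => t0; have [->|pN0] := eqVneq p 0%R.
    by exists 0%R; rewrite !mulr0 subr0 ltW.
  have p_gt0 : (0 < p)%R by rewrite lt_def pN0.
  exists (ln (- t / p)); rewrite mulr0 sub0r lnK ?posrE ?divr_gt0 ?oppr_gt0//.
  by rewrite divfK// opprK.
have q_gt0 : (0 < q)%R by rewrite lt_def qN0.
case: eqVneq => [->|pN0].
  by move=> _; exists (t / q - 1)%R; rewrite mulr0 subr0 subrK divfK.
have p_gt0 : (0 < p)%R by rewrite lt_def pN0.
rewrite lte_fin => /ltW tl; exists (ln (q / p)); apply: (le_trans tl).
by rewrite lnK ?posrE ?divr_gt0// divfK// mulrDl mul1r addrK mulrC.
Qed.

(** The coordinates of [s] are free of each other, so that the suprema add
    up. This turns an upper bound on the objective, which is not continuous at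
    the boundary of the orthant, into a family of closed linear conditions. *)
Lemma objective_le_dual n (p1 p2 : 'cV[R]_n) (V : \bar R) :
  (forall l, 0 <= p1 l ord0)%R -> (forall l, 0 <= p2 l ord0)%R ->
  (forall s : 'I_n -> R,
     (\sum_l ((s l + 1) * p2 l ord0 - expR (s l) * p1 l ord0)%R)%:E <= V) ->
  objective p1 p2 <= V.
Proof.
move=> p1_ge0 p2_ge0; case: V => [r||]; last 2 first.
- by rewrite leey.
- by move=> /(_ (fun=> 0%R)); rewrite leeNy_eq.
move=> H.
have [[l0 l0y]|] := pselect (exists l, log_term (p2 l ord0) (p1 l ord0) = +oo).
  pose v := (\sum_(l | l != l0) ((0 + 1) * p2 l ord0 - expR 0 * p1 l ord0))%R.
  have [|s0 s0P] := @log_term_gt (p2 l0 ord0) (p1 l0 ord0) (r + 1 - v)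
    (p2_ge0 _) (p1_ge0 _); first by rewrite l0y ltry.
  have := H (fun l => if l == l0 then s0 else 0%R).
  rewrite (bigD1 l0)//= eqxx (eq_bigr (fun l =>
    ((0 + 1) * p2 l ord0 - expR 0 * p1 l ord0)%R)); last first.
    by move=> l /negPf ->.
  by rewrite -/v lee_fin => Hr; exfalso; clear -s0P Hr; lra.
move=> noy; pose t l := fine (log_term (p2 l ord0) (p1 l ord0)).
have tE l : log_term (p2 l ord0) (p1 l ord0) = (t l)%:E.
  rewrite /t fineK//; move: noy; rewrite /log_term => noy.
  case: eqP => // q0; case: eqP => // p0; exfalso; apply: noy.
  by exists l; case: eqP => // _; case: eqP.
rewrite /objective (eq_bigr (fun l => (t l)%:E))//= sumEFin.
rewrite lee_fin; apply/ler_addgt0Pr => e e0.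
have /choice[s sP] l : exists s,
    (t l - e / n%:R <= (s + 1) * p2 l ord0 - expR s * p1 l ord0)%R.
  apply: log_term_gt => //; rewrite tE lte_fin ltrBlDr ltrDl divr_gt0//.
  by rewrite ltr0n (leq_ltn_trans _ (ltn_ord l)).
have := H s; rewrite lee_fin -lerBlDr => /(le_trans _); apply.
have [n0|n0] := eqVneq n 0%N.
  move: p1 p2 t s sP {H noy p1_ge0 p2_ge0 tE}; rewrite n0 => *.
  by rewrite !big_ord0; lra.
apply: (@le_trans _ _ (\sum_l (t l - e / n%:R))%R); last first.
  by apply: ler_sum => l _; exact: sP.
by rewrite sumrB sumr_const card_ord -[(e / n%:R *+ n)%R]mulr_natr divfK
  ?pnatr_eq0.
Qed.

End Dual.

(** * Finitely supported measures *)

Section FiniteAtomic.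
Context {d : measure_display} {T : measurableType d} {R : realType}.
Local Open Scope ereal_scope.

(** Built by induction from scaled Dirac measures; the formula for integrals
    comes along, and then determines all measures with these values. *)
Lemma finite_atomic_measure (I : Type) (q : I -> R) (f : I -> T) (s : seq I) :
  (forall i, (0 <= q i)%R) ->
  exists m : {measure set T -> \bar R},
    (forall A, m A = \sum_(i <- s) (q i)%:E * \d_(f i) A) /\
    forall g : T -> \bar R, measurable_fun setT g -> (forall t, 0 <= g t) ->
      \int[m]_t g t = \sum_(i <- s) (q i)%:E * g (f i).
Proof.
move=> q0; elim: s => [|i s [m [mE intm]]].
  exists (mzero : {measure set T -> \bar R}); split=> [A|g mg g0].
    by rewrite big_nil.
  by rewrite big_nil integral_measure_zero.
pose mi : {measure set T -> \bar R} := mscale (NngNum (q0 i)) (\d_(f i)).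
exists (measure_add mi m : {measure set T -> \bar R}); split=> [A|g mg g0].
  by rewrite big_cons [LHS]measure_addE mE.
rewrite big_cons ge0_integral_measure_add// intm//; congr (_ + _).
by rewrite ge0_integral_mscale//= integral_dirac// diracT mul1e.
Qed.

Section Integral.
Context (I : finType) (q : I -> R) (f : I -> T) (q0 : forall i, (0 <= q i)%R).
Context (m : {measure set T -> \bar R}).
Context (mE : forall A, m A = \sum_i (q i)%:E * \d_(f i) A).

Lemma finite_atomic_eq0 A i : m A = 0 -> A (f i) -> q i = 0%R.
Proof.
move=> mA0 Afi; apply/eqP; rewrite eq_le q0 andbT -lee_fin -[leRHS]mA0 mE.
rewrite (bigD1 i)//= diracE mem_set// mule1 leeDl// sume_ge0// => j _.
by rewrite mule_ge0 ?lee_fin.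
Qed.

Lemma ge0_integral_finite_atomic (g : T -> \bar R) :
  measurable_fun setT g -> (forall t, 0 <= g t) ->
  \int[m]_t g t = \sum_i (q i)%:E * g (f i).
Proof.
move=> mg g0.
have [m' [m'E <-//]] := finite_atomic_measure I q f (index_enum I) q0.
by apply: eq_measure_integral => A mA _; rewrite mE m'E.
Qed.

Lemma integral_finite_atomic (g : T -> R) : measurable_fun setT g ->
  \int[m]_t (g t)%:E = (\sum_i q i * g (f i))%R%:E.
Proof.
move=> mg; have mEg : measurable_fun setT (EFin \o g) by exact/measurable_EFinP.
rewrite integralE /= !ge0_integral_finite_atomic//;
  [|exact: measurable_funeneg|exact: measurable_funepos].
rewrite (_ : \sum_i _ = (\sum_i q i * Num.max (g (f i)) 0)%R%:E); last first.
  by rewrite -sumEFin; apply: eq_bigr => i _; rewrite funeposE -EFin_max.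
rewrite [X in _ - X](_ : _ =
    (\sum_i q i * Num.max (- g (f i)) 0)%R%:E); last first.
  by rewrite -sumEFin; apply: eq_bigr => i _; rewrite funenegE -EFin_max.
rewrite -EFinB -sumrB; congr (_%:E); apply: eq_bigr => i _; rewrite -mulrBr.
congr (_ * _)%R; have [g0|g0] := leP 0%R (g (f i)).
  by rewrite max_r ?oppr_le0// subr0.
by rewrite max_l ?oppr_ge0 ?ltW// sub0r opprK.
Qed.

End Integral.

(** An alias that carries the proof of total mass one, on which the structure
    of a probability can be attached. *)
Definition unit_mass (m : {measure set T -> \bar R}) (_ : m setT = 1) :
  set T -> \bar R := m.

Section UnitMass.
Context (m : {measure set T -> \bar R}) (m1 : m setT = 1).
HB.instance Definition _ := Measure.on (unit_mass m m1).
HB.instance Definition _ :=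
  Measure_isProbability.Build _ _ _ (unit_mass m m1) m1.
End UnitMass.

Lemma finite_atomic_probability (I : finType) (q : I -> R) (f : I -> T) :
  (forall i, 0 <= q i)%R -> (\sum_i q i = 1)%R ->
  exists P : probability T R, forall A, P A = \sum_i (q i)%:E * \d_(f i) A.
Proof.
move=> q0 q1; have [m [mE _]] := finite_atomic_measure I q f (index_enum I) q0.
have m1 : m setT = 1.
  by rewrite mE; under eq_bigr do rewrite diracT mule1; rewrite sumEFin q1.
by exists (unit_mass m m1 : probability T R).
Qed.

End FiniteAtomic.

Section KLFiniteAtomic.
Context {d : measure_display} {T : measurableType d} {R : realType}.
Context (I : finType) (p1 p2 : I -> R) (z : I -> T) (mu nu : probability T R).
Local Open Scope ereal_scope.
Context (p1_ge0 : forall i, (0 <= p1 i)%R).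
Context (p2_ge0 : forall i, (0 <= p2 i)%R).
Context (muE : forall A, mu A = \sum_i (p1 i)%:E * \d_(z i) A).
Context (nuE : forall A, nu A = \sum_i (p2 i)%:E * \d_(z i) A).

(** The points [z i] may coincide, in which case aggregating the masses can
    make the inequality strict (log-sum inequality). No regrouping of the atoms
    is needed: with [h] the density, and unless the right-hand side is
    infinite, [ln x <= x - 1] bounds each [p2 i * ln (h (z i))] by the
    corresponding term of the right-hand side plus [p1 i * h (z i) - p2 i], and
    these corrections sum up to [1 - 1]. *)
Lemma KL_finite_atomic_le : KL nu mu <= \sum_i log_term (p2 i) (p1 i).
Proof.
have [[i0 [p2i0 p1i0]]|fin] :=
    pselect (exists i, p2 i != 0%R /\ p1 i = 0%R).
  suff -> : \sum_i log_term (p2 i) (p1 i) = +oo by rewrite leey.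
  apply/esum_eqyP => [i _|]; last first.
    by exists i0; split=> //; rewrite /log_term (negbTE p2i0) p1i0 eqxx.
  by rewrite /log_term; case: ifP => // _; case: ifP.
have p1N0 i : p2 i != 0%R -> p1 i != 0%R.
  by move=> p2i; apply/eqP => p1i; apply: fin; exists i.
have numu : nu `<< mu.
  apply/null_content_dominatesP => A mA muA0.
  rewrite nuE big1// => i _; rewrite diracE.
  have [/set_mem Azi|_] := boolP (z i \in A); last by rewrite mule0.
  have [->|/p1N0/eqP[]] := eqVneq (p2 i) 0%R; first by rewrite mul0e.
  exact: (finite_atomic_eq0 _ _ _ p1_ge0 _ muE A).
have [h [mh h0 cov ->]] := KL_density _ _ numu.
have sum1 : (\sum_i p1 i * h (z i) = 1)%R.
  apply: EFin_inj; rewrite -(integral_finite_atomic _ _ _ p1_ge0 _ muE)//.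
  transitivity (\int[nu]_t (cst 1) t); last first.
    by rewrite integral_cst// [X in _ * X]probability_setT mule1.
  by rewrite cov//; apply: eq_integral => t _; rewrite mul1e.
have sum2 : (\sum_i p2 i = 1)%R.
  apply: EFin_inj; rewrite -(probability_setT nu) nuE -sumEFin.
  by apply: eq_bigr => i _; rewrite diracT mule1.
have nuZ : nu (h @^-1` [set 0%R]) = 0.
  set Z := h @^-1` _; have mZ : measurable Z by rewrite -[Z]setTI; apply: mh.
  have -> : nu Z = \int[nu]_t (\1_Z t)%:E by rewrite integral_indic// setIT.
  rewrite cov;
    [|exact/measurable_EFinP/measurable_indic|by move=> t; rewrite lee_fin].
  apply: integral0_eq => t _; rewrite indicE.
  have [/set_mem tZ|_] := boolP (t \in Z); last by rewrite mul0e.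
  by rewrite (_ : h t = 0%R)// mule0.
have h_gt0 i : p2 i != 0%R -> (0 < h (z i))%R.
  move=> p2i; rewrite lt_def h0 andbT; apply: contra p2i => /eqP hz.
  by apply/eqP; exact: (finite_atomic_eq0 _ _ _ p2_ge0 _ nuE _ _ nuZ).
rewrite (integral_finite_atomic _ _ _ p2_ge0 _ nuE);
  last exact: measurableT_comp.
pose L i := (if p2 i == 0 then 0 else p2 i * ln (p2 i / p1 i))%R.
rewrite (eq_bigr (fun i => (L i)%:E)); last first.
  move=> i _; rewrite /log_term /L; case: eqVneq => // p2i.
  by rewrite (negbTE (p1N0 _ p2i)).
rewrite sumEFin lee_fin.
have -> : (\sum_i L i = \sum_i (L i + (p1 i * h (z i) - p2 i)))%R.
  by rewrite big_split/= sumrB sum1 sum2 subrr addr0.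
apply: ler_sum => i _; rewrite /L; case: eqVneq => [->|p2i].
  by rewrite mul0r subr0 add0r mulr_ge0.
have p2_gt0 : (0 < p2 i)%R by rewrite lt_def p2i p2_ge0.
have p1_gt0 : (0 < p1 i)%R by rewrite lt_def p1N0//= p1_ge0.
have hz := h_gt0 _ p2i.
have le1 : (ln (h (z i) * p1 i / p2 i) <= h (z i) * p1 i / p2 i - 1)%R.
  rewrite -{1}[(_ / _)%R](subrK 1%R) addrC le_ln1Dx// ltrBrDl subrr.
  by rewrite divr_gt0// mulr_gt0.
rewrite -(ler_pM2l p2_gt0) in le1; move: le1.
rewrite mulrBr mulr1 mulrCA divff// mulr1 -mulrA lnM ?posrE ?divr_gt0//.
rewrite !ln_div ?posrE//; nra.
Qed.

End KLFiniteAtomic.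

(** * Borel measurability in a metric space and its square *)

Section BorelMeasurability.

Lemma generated_measurable (T U : pointedType) (GT : set (set T))
    (GU : set (set U)) (f : T -> U) :
  (forall B, GU B -> GT (f @^-1` B)) ->
  measurable_fun setT (f : g_sigma_algebraType GT -> g_sigma_algebraType GU).
Proof.
move=> GTU; apply: (@measurability _ _ (g_sigma_algebraType GT)
  (g_sigma_algebraType GU) setT f GU) => //.
by move=> _ [B GB <-]; rewrite setTI; apply: sub_sigma_algebra; exact: GTU.
Qed.

Lemma generated_measurable_real (R : realType) (T : pointedType)
    (GT : set (set T)) (f : T -> R) :
  (forall B : set R, open B -> GT (f @^-1` B)) ->
  measurable_fun setT (f : g_sigma_algebraType GT -> R).
Proof.
move=> GTf; apply: (@measurability _ _ (g_sigma_algebraType GT) R setT f _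
  (RGenOpens.measurableE R)).
move=> _ [_ [x [y ->]] <-]; rewrite setTI; apply: sub_sigma_algebra.
by apply: GTf; exact: interval_open.
Qed.

Context {R : realType} {X : pmetricType R}.

Lemma mdist_continuous  :
  continuous (fun w : X * X => mdist w.1 w.2 : R).
Proof.
move=> [u v]; apply/cvgrPdist_lt => e e0.
have e2 : 0 < e / 2 by rewrite divr_gt0.
exists (ball u (e / 2), ball v (e / 2)); first by split; exact: nbhsx_ballx.
move=> [u' v'] [] /=; rewrite !ballEmdist/= => uu' vv'.
have := metric_triangle u u' v; have := metric_triangle u' v' v.
have := metric_triangle u' u v'; have := metric_triangle u v v'.
rewrite (metric_sym v' v) (metric_sym u' u) => *.
rewrite ltr_norml; apply/andP; split; lra.
Qed.

Lemma measurable_mdist :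
  measurable_fun setT (fun w : borelType (X * X)%type => mdist w.1 w.2 : R).
Proof.
apply: (@generated_measurable_real R (X * X)%type) => B oB.
by apply: open_comp => // w _; exact: mdist_continuous.
Qed.

Lemma measurable_fst_borel :
  measurable_fun setT (fst : borelType (X * X)%type -> borelType X).
Proof.
apply: (@generated_measurable (X * X)%type X) => B oB.
by apply: open_comp => // w _; exact: cvg_fst.
Qed.

Lemma measurable_snd_borel :
  measurable_fun setT (snd : borelType (X * X)%type -> borelType X).
Proof.
apply: (@generated_measurable (X * X)%type X) => B oB.
by apply: open_comp => // w _; exact: cvg_snd.
Qed.

Lemma measurable_mdistr (v : X) :
  measurable_fun setT (fun u : borelType X => mdist u v : R).
Proof.
apply: (@generated_measurable_real R X) => B oB.
apply: open_comp => // u _; apply/cvgrPdist_lt => e e0.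
apply: filterS (nbhsx_ballx u e e0) => u'; rewrite ballEmdist/= => uu'.
have := metric_triangle u u' v; have := metric_triangle u' u v.
rewrite (metric_sym u' u) => *.
rewrite ltr_norml; apply/andP; split; lra.
Qed.

Lemma measurable_point (v : X) : measurable ([set v] : set (borelType X)).
Proof.
have -> : [set v] = setT `&` (fun u => mdist u v : R) @^-1` [set 0].
  rewrite setTI; apply/seteqP; split=> [u ->|u /mdist_positivity]//=.
  exact: mdistxx.
by apply: measurable_mdistr => //; exact: measurable_set1.
Qed.

End BorelMeasurability.

(** * Disintegration of a coupling with a finitely supported law *)

Section ConditionalProbability.
Context {d d' : measure_display} {T : measurableType d} {T' : measurableType d'}
  {R : realType}.
Context {P : probability T' R} {D : set T'} {f : T' -> T}.
Context (mD : measurable D) (mf : measurable_fun setT f).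
Local Open Scope ereal_scope.

Definition slice (A : set T) : \bar R := P (f @^-1` A `&` D).

Let mpreimage A : measurable A -> measurable (f @^-1` A).
Proof. by move=> mA; rewrite -[X in measurable X]setTI; exact: mf. Qed.

Let slice0 : slice set0 = 0.
Proof. by rewrite /slice preimage_set0 set0I measure0. Qed.

Let slice_ge0 A : 0 <= slice A. Proof. exact: measure_ge0. Qed.

Let slice_sigma_additive : semi_sigma_additive slice.
Proof.
move=> F mF tF mUF; rewrite /slice preimage_bigcup setI_bigcupl.
apply: measure_semi_sigma_additive.
- by move=> n; apply: measurableI => //; exact: mpreimage.
- apply/trivIsetP => /= i j _ _ ij; rewrite setIACA -preimage_setI.
  by move/trivIsetP : tF => /(_ _ _ _ _ ij) ->//; rewrite preimage_set0 set0I.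
- rewrite -setI_bigcupl -preimage_bigcup.
  by apply: measurableI => //; exact: mpreimage.
Qed.

HB.instance Definition _ := isMeasure.Build _ _ _
  slice slice0 slice_ge0 slice_sigma_additive.

Let slice_fin : fin_num_fun slice.
Proof.
move=> A mA; rewrite /slice fin_num_measure//.
by apply: measurableI => //; exact: mpreimage.
Qed.

HB.instance Definition _ := Measure_isFinite.Build _ _ _ slice slice_fin.

Lemma ge0_integral_slice (g : T -> \bar R) :
  measurable_fun setT g -> (forall t, 0 <= g t) ->
  \int[slice]_t g t = \int[P]_(w in D) g (f w).
Proof.
move=> mg g0; 
have mgf : measurable_fun setT (g \o f) by exact: measurableT_comp.
transitivity (\int[pushforward (mrestr P mD) f]_t g t).
  by apply: eq_measure_integral.
rewrite ge0_integral_pushforward//.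
rewrite preimage_setT -(setUv D) ge0_integral_setU//=; last 3 first.
- exact: measurableC.
- by rewrite setUv.
- exact/disj_set2P/setICr.
rewrite [X in _ + X]null_set_integral ?adde0.
- by apply: eq_measure_integral => A mA AD; rewrite /= /mrestr setIidl.
- exact: measurableC.
- exact: measurable_funTS.
- by rewrite /= /mrestr setICl measure0.
Qed.

(** [a] is the conditional probability of the event [D] given [f], that is,
    the density with respect to the law [Q] of [f] of the part of this law that
    is carried by [D]. *)
Lemma conditional_probability (Q : probability T R) :
  (forall A, measurable A -> P (f @^-1` A) = Q A) ->
  exists a : T -> R, [/\ measurable_fun setT a, forall t, (0 <= a t)%R &
    forall g : T -> \bar R, measurable_fun setT g -> (forall t, 0 <= g t) ->
      \int[P]_(w in D) g (f w) = \int[Q]_t (g t * (a t)%:E)].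
Proof.
move=> PQ; have sQ : slice `<< Q.
  apply/null_content_dominatesP => A mA QA0; apply/eqP.
  have := PQ _ mA; rewrite QA0 => PA0.
rewrite eq_le measure_ge0 andbT -[X in _ <= X]PA0 /= /slice.
by apply: measureIl => //; exact: mpreimage.
pose r := Radon_Nikodym_SigmaFinite.f slice Q.
have rE t : (fine (r t))%:E = r t.
  by rewrite fineK//; exact: Radon_Nikodym_SigmaFinite.f_fin_num.
exists (fine \o r); split.
- apply/measurable_EFinP; rewrite (_ : _ \o _ = r); last exact/funext.
  by apply: (measurable_int Q); exact: Radon_Nikodym_SigmaFinite.f_integrable.
- by move=> t; rewrite -lee_fin /= rE; exact: Radon_Nikodym_SigmaFinite.f_ge0.
- move=> g mg g0; rewrite -ge0_integral_slice//.
  rewrite -(Radon_Nikodym_SigmaFinite.change_of_variables sQ)//.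
  by apply: eq_integral => t _; rewrite /= rE.
Qed.

End ConditionalProbability.

Section CouplingDensities.
Context {R : realType} {X : pmetricType R} {n : nat}.
Context (w : 'cV[R]_n) (z : 'I_n -> X).
Context (w0 : forall l, 0 <= w l ord0) (w1 : \sum_l w l ord0 = 1).

(** Several indices may name the same point: index [l] gets the share of the
    mass of the atom [z l] that is proportional to its weight. *)
Definition atom_share (l : 'I_n) : R :=
  w l ord0 / \sum_(j | z j == z l) w j ord0.

Lemma atom_share_ge0 l : 0 <= atom_share l.
Proof. by rewrite divr_ge0// sumr_ge0. Qed.

Let mass_eq0 l : \sum_(j | z j == z l) w j ord0 = 0 -> w l ord0 = 0.
Proof.
move=> S0; apply/eqP; rewrite eq_le w0 andbT -S0 (bigD1 l)//= lerDl.
by rewrite sumr_ge0.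
Qed.

Lemma atom_shareK l :
  atom_share l * (\sum_(j | z j == z l) w j ord0) = w l ord0.
Proof.
rewrite /atom_share; have [S0|S0] := eqVneq (\sum_(j | z j == z l) w j ord0) 0.
  by rewrite S0 mulr0 mass_eq0.
by rewrite divfK.
Qed.

Lemma sum_atom_share l : w l ord0 != 0 ->
  \sum_(j | z j == z l) atom_share j = 1.
Proof.
move=> wl0; rewrite /atom_share.
under eq_bigr => j /eqP -> do [].
rewrite -mulr_suml divff//; apply: contra wl0 => /eqP/mass_eq0 ->//.
Qed.

Local Open Scope ereal_scope.
Context {P : probability (borelType X) R}
  {G : probability (borelType (X * X)%type) R}.
Context (coupG : couplings P (atomic w z) G).

Let D l : set (borelType (X * X)%type) := [set u | u.2 = z l].

Let mfst := @measurable_fst_borel R X.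
Let msnd := @measurable_snd_borel R X.

Let mD l : measurable (D l).
Proof.
have -> : D l = setT `&` snd @^-1` [set z l] by rewrite setTI.
by apply: msnd => //; exact: measurable_point.
Qed.

Let G_snd (B : set (borelType X)) : measurable B ->
  G (snd @^-1` B) = atomic w z B.
Proof.
move=> mB; rewrite -coupG.2//; congr (G _).
by apply/seteqP; split=> u /=; [|case].
Qed.

Let G_fst (A : set (borelType X)) : measurable A -> G (fst @^-1` A) = P A.
Proof.
move=> mA; rewrite -coupG.1//; congr (G _).
by apply/seteqP; split=> u /=; [|case].
Qed.

(** The second marginal is carried by the points of positive weight, at which
    the shares sum up to one by [sum_atom_share]. *)
Lemma integral_atoms (g : borelType (X * X)%type -> \bar R) :
  measurable_fun setT g -> (forall u, 0 <= g u) ->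
  \sum_l (atom_share l)%:E * \int[G]_(u in D l) g u = \int[G]_u g u.
Proof.
move=> mg g0; pose phi (v : X) := (\sum_(j | z j == v) atom_share j)%R.
have phiE v : phi v = (\sum_j atom_share j * \1_[set z j] v)%R.
  rewrite /phi big_mkcond; apply: eq_bigr => j _; rewrite indicE in_set1.
  by rewrite (eq_sym v); case: eqP => _; rewrite ?mulr1 ?mulr0.
have mphi : measurable_fun setT (phi : borelType X -> R).
  rewrite (_ : phi = fun v => \sum_j atom_share j * \1_[set z j] v)%R;
    last first.
    by apply/funext => v; exact: phiE.
  apply: measurable_sum => j; apply: measurable_funM => //.
  by apply: measurable_indic; exact: measurable_point.
pose B : set (borelType X) := [set v | phi v != 1%R].
have mB : measurable B.
  rewrite (_ : B = setT `&` phi @^-1` (~` [set 1%R])).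
    by apply: mphi => //; apply: measurableC; exact: measurable_set1.
  by rewrite setTI; apply/seteqP; split=> v /eqP.
transitivity (\int[G]_u ((phi u.2)%:E * g u)); last first.
  apply: ae_eq_integral => //.
    apply: emeasurable_funM => //; apply/measurable_EFinP.
    exact: (measurableT_comp mphi msnd).
  exists (snd @^-1` B); split.
  - by rewrite -[X in measurable X]setTI; exact: msnd.
  - rewrite [LHS](G_snd _ mB) /atomic big1// => l _.
    have [->|wl0] := eqVneq (w l ord0) 0%R; first by rewrite mul0e.
    rewrite diracE memNset ?mule0//= /B /= /phi.
    by rewrite sum_atom_share// eqxx.
  - move=> u /= uN; apply/negP => /eqP phi1; apply: uN => _.
    by rewrite phi1 mul1e.
have mgD l : measurable_fun setT (g \_ (D l)).
  by apply: (measurable_restrictT _ (mD l)).1; exact: measurable_funTS.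
have gD0 l u : 0 <= (g \_ (D l)) u by rewrite erestrict_ge0.
transitivity (\int[G]_u \sum_l (atom_share l)%:E * (g \_ (D l)) u).
  rewrite ge0_integral_sum//.
  - apply: eq_bigr => l _; rewrite ge0_integralZl_EFin ?atom_share_ge0//.
    by rewrite -integral_mkcond.
  - by move=> l; exact: measurable_funeM.
  - by move=> l u _; rewrite mule_ge0 ?lee_fin ?atom_share_ge0.
apply: eq_integral => u _; rewrite phiE -sumEFin ge0_sume_distrl; last first.
  by move=> l _; rewrite lee_fin mulr_ge0 ?atom_share_ge0.
apply: eq_bigr => l _; rewrite (EFinM _ (\1_[set z l] u.2)) -muleA.
congr (_ * _).
rewrite patchE indicE; have -> : (u.2 \in [set z l]) = (u \in D l).
  by apply/idP/idP => /set_mem ?; exact/mem_set.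
by case: ifPn => _; rewrite ?mul1e ?mul0e.
Qed.

(** Disintegration of a coupling with a finitely supported law: [a l t] is the
    conditional probability, given that the first coordinate is [t], that the
    second one comes from the index [l]. The conditional probabilities sum up
    to one only almost everywhere; outside of that set they are replaced by [w]
    so that [a ^~ t] is a law for every [t]. This matters because it will also
    be integrated against another measure than [P]. *)
Lemma coupling_density : exists a : 'I_n -> borelType X -> R,
  [/\ forall l, measurable_fun setT (a l), forall l t, (0 <= a l t)%R,
      forall t, (\sum_l a l t = 1)%R,
      forall l, (\int[P]_t a l t = w l ord0)%R &
      \sum_l \int[P]_t (a l t * mdist t (z l))%:E <=
      \int[G]_u (mdist u.1 u.2)%:E].
Proof.
have /choice[al alP] l := conditional_probability (mD l) mfst P G_fst.
pose b l t := (atom_share l * al l t)%R.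
have mb l : measurable_fun setT (b l).
  by apply: measurable_funM => //; have [] := alP l.
have b0 l t : (0 <= b l t)%R.
  by rewrite mulr_ge0 ?atom_share_ge0//; have [_ ->] := alP l.
have intb l (g : borelType X -> \bar R) : measurable_fun setT g ->
    (forall t, 0 <= g t) ->
    \int[P]_t (g t * (b l t)%:E) =
    (atom_share l)%:E * \int[G]_(u in D l) g u.1.
  move=> mg g0; have [mal al0 ->//] := alP l.
  rewrite -ge0_integralZl_EFin ?atom_share_ge0//.
  - by apply: eq_integral => t _; rewrite EFinM muleCA.
  - by move=> t _; rewrite mule_ge0 ?lee_fin.
  - by apply: emeasurable_funM => //; exact/measurable_EFinP.
have mbE l : measurable_fun setT (EFin \o b l) by exact/measurable_EFinP.
have msumb : measurable_fun setT (fun t => \sum_l b l t)%R.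
  by apply: measurable_sum => l; exact: mb.
have sum_intb (g : borelType X -> \bar R) : measurable_fun setT g ->
    (forall t, 0 <= g t) ->
    \int[P]_t (g t * (\sum_l b l t)%R%:E) = \int[G]_u g u.1.
  move=> mg g0; rewrite -(integral_atoms (fun u => g u.1))//; last first.
    exact: (measurableT_comp mg mfst).
  under [RHS]eq_bigr do rewrite -intb//.
  rewrite -ge0_integral_sum//.
  - apply: eq_integral => t _; rewrite -sumEFin ge0_sume_distrr//.
    by move=> l _; rewrite lee_fin.
  - by move=> l; apply: emeasurable_funM => //; exact: mbE.
  - by move=> l t _; rewrite mule_ge0 ?lee_fin.
have sumb : ae_eq P setT (cst 1) (fun t => (\sum_l b l t)%R%:E).
  apply: integral_ae_eq => //.
  - exact: finite_measure_integrable_cst.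
  - exact/measurable_EFinP.
  move=> A _ mA; rewrite integral_cst// mul1e -[LHS](G_fst _ mA).
  have mA1 : measurable_fun setT (fun t : borelType X => (\1_A t : R)%:E).
    exact/measurable_EFinP/measurable_indic.
  transitivity (\int[G]_u (\1_A u.1)%:E).
    rewrite (_ : (fun u => _) = (fun u => (\1_(fst @^-1` A) u)%:E))//.
    rewrite integral_indic ?setIT// -[X in measurable X]setTI.
    exact: mfst.
  have <- := sum_intb _ mA1; last by move=> t; rewrite lee_fin.
  rewrite [RHS]integral_mkcond; apply: eq_integral => t _.
  by rewrite patchE indicE; case: ifPn => _; rewrite ?mul1e ?mul0e.
pose a l t := (if (\sum_l b l t == 1)%R then b l t else w l ord0)%R.
have ma l : measurable_fun setT (a l).
  by apply: measurable_fun_ifT => //; exact: measurable_fun_eqr.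
have a0 l t : (0 <= a l t)%R by rewrite /a; case: ifP.
have ab l (g : borelType X -> R) : measurable_fun setT g ->
    \int[P]_t (a l t * g t)%:E = \int[P]_t (b l t * g t)%:E.
  move=> mg; apply: ae_eq_integral => //.
  - by apply/measurable_EFinP; exact: measurable_funM.
  - by apply/measurable_EFinP; exact: measurable_funM.
  apply: filterS sumb => t /(_ I)/= -[sb1] _.
  by rewrite /a -sb1 eqxx.
exists a; split=> //.
- by move=> t; rewrite /a; case: (eqVneq (\sum_l b l t)%R 1%R).
- move=> l; rewrite /Rintegral.
  under eq_integral do rewrite -[a l _]mulr1.
  rewrite (ab l (cst 1%R))//.
  under eq_integral do rewrite /= mulrC EFinM.
  rewrite (intb l (cst 1))// integral_cst// mul1e.
  have GD : G (D l) = (\sum_(j | z j == z l) w j ord0)%R%:E.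
    rewrite (G_snd [set z l]); last exact: measurable_point.
    rewrite /atomic -sumEFin [RHS]big_mkcond; apply: eq_bigr => j _.
    rewrite diracE in_set1; case: eqP => _; rewrite ?mule1 ?mule0//.
  by rewrite [X in _ * X]GD -EFinM atom_shareK.
- under eq_bigr => l _.
    rewrite ab; last exact: measurable_mdistr.
    under eq_integral do rewrite mulrC EFinM.
    rewrite (intb l (fun t => (mdist t (z l))%:E)); last 2 first.
    + apply/measurable_EFinP; exact: measurable_mdistr.
    + by move=> t; rewrite lee_fin mdist_ge0.
    rewrite (@eq_integral _ _ _ G (D l) (fun u => (mdist u.1 u.2)%:E));
      last first.
      by move=> u /set_mem ->.
    over.
  rewrite (integral_atoms (fun u => (mdist u.1 u.2)%:E))//.
  + apply/measurable_EFinP; exact: measurable_mdist.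
  + by move=> u; rewrite lee_fin mdist_ge0.
Qed.

End CouplingDensities.

(** * Averaging the relay over a distribution *)

Section MeanRelay.
Context {R : realType} {X : pmetricType R} {n : nat} (z : 'I_n -> X).
Implicit Types (a b : 'I_n -> borelType X -> R)
  (P : probability (borelType X) R).

Definition relay_at a b (t : borelType X) : 'I_n -> 'I_n -> R :=
  relay (fun k => mdist t (z k)) (a ^~ t) (b ^~ t).

(** The transport plan that results from relaying each point [t] of [P]. *)
Definition mean_relay P a b (l m : 'I_n) : R := \int[P]_t relay_at a b t l m.

(** Away from zero, the inverse is the exponential of minus the logarithm. *)
Lemma measurable_relay_ratio d (T : measurableType d) (u v : T -> R) :
  measurable_fun setT u -> measurable_fun setT v ->
  (forall t, 0 <= u t) -> (forall t, 0 <= v t) ->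
  measurable_fun setT (fun t => relay_ratio (u t) (v t)).
Proof.
move=> mu mv u0 v0; have muv : measurable_fun setT (fun t => u t + v t).
  exact: measurable_funD.
rewrite (_ : (fun t => _) = fun t => if u t + v t == 0 then 2^-1 else
    u t * expR (- ln (u t + v t))).
  apply: measurable_fun_ifT => //; first exact: measurable_fun_eqr.
  apply: measurable_funM => //; apply: measurableT_comp => //.
  by apply: measurableT_comp => //; apply: measurableT_comp.
apply/funext => t; rewrite /relay_ratio; case: ifPn => // uv.
by rewrite expRN lnK// posrE lt_def uv addr_ge0.
Qed.

Context (a b : 'I_n -> borelType X -> R).
Context (ma : forall l, measurable_fun setT (a l))
  (mb : forall l, measurable_fun setT (b l))
  (a0 : forall l t, 0 <= a l t) (b0 : forall l t, 0 <= b l t)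
  (a1 : forall t, \sum_l a l t = 1) (b1 : forall t, \sum_l b l t = 1).

Lemma measurable_relay_at l m :
  measurable_fun setT (fun t => relay_at a b t l m).
Proof.
have mr j k : measurable_fun setT (fun t : borelType X =>
    relay_ratio (mdist t (z j)) (mdist t (z k))).
  by apply: measurable_relay_ratio => *;
    [exact: measurable_mdistr|exact: measurable_mdistr|exact: mdist_ge0..].
apply: measurable_funD.
  by apply: measurable_funM => //; exact: measurable_funM.
apply: measurable_funM => //; apply: measurable_funM => //.
by apply: measurable_sum => k; exact: measurable_funM.
Qed.

Lemma relay_at_ge0 t l m : 0 <= relay_at a b t l m.
Proof. by apply: relay_ge0 => // k; exact: mdist_ge0. Qed.

Lemma relay_at_row t l : \sum_m relay_at a b t l m = a l t.
Proof. exact: relay_row. Qed.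

Lemma relay_at_le1 t l m : relay_at a b t l m <= 1.
Proof.
rewrite -(a1 t) (bigD1 l)//= -relay_at_row (bigD1 m)//= -addrA lerDl.
by rewrite addr_ge0// sumr_ge0// => k _; exact: relay_at_ge0.
Qed.

Lemma integrable_relay_at P l m :
  P.-integrable setT (EFin \o (fun t => relay_at a b t l m)).
Proof.
apply: unit_integrable; first exact: measurable_relay_at.
by move=> t; rewrite relay_at_ge0 relay_at_le1.
Qed.

Lemma mean_relay_ge0 P l m : 0 <= mean_relay P a b l m.
Proof. by apply: Rintegral_ge0 => t _; exact: relay_at_ge0. Qed.

Lemma mean_relay_row P l : \sum_m mean_relay P a b l m = \int[P]_t a l t.
Proof.
rewrite -Rintegral_sum; last by move=> m; exact: integrable_relay_at.
by apply: eq_Rintegral => t _; rewrite relay_at_row.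
Qed.

Lemma mean_relay_col P m :
  \sum_l mean_relay P a b l m = \int[P]_t (\sum_l relay_at a b t l m).
Proof.
by rewrite -Rintegral_sum// => l; exact: integrable_relay_at.
Qed.

Lemma mean_relay_cost P :
  ((\sum_l \sum_m mean_relay P a b l m * mdist (z l) (z m))%:E <=
  \sum_l \int[P]_t (a l t * mdist t (z l))%:E)%E.
Proof.
have intc l m : P.-integrable setT (EFin \o
    (fun t => relay_at a b t l m * mdist (z l) (z m))).
  exact: (integrableZr measurableT (mdist (z l) (z m))
    (integrable_relay_at P l m)).
have mc l m : measurable_fun setT
    (fun t => relay_at a b t l m * mdist (z l) (z m)).
  by apply: measurable_funM => //; exact: measurable_relay_at.
have -> : \sum_l \sum_m mean_relay P a b l m * mdist (z l) (z m) =
    \int[P]_t (\sum_l \sum_m relay_at a b t l m * mdist (z l) (z m)).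
  rewrite Rintegral_sum.
    apply: eq_bigr => l _; rewrite Rintegral_sum//.
    by apply: eq_bigr => m _; rewrite RintegralZr//; exact: integrable_relay_at.
  by move=> l; exact: integrable_Rsum.
rewrite /Rintegral fineK; last first.
  apply: (integrable_fin_num measurableT); apply: integrable_Rsum => l.
  exact: integrable_Rsum.
have cost0 l m : 0 <= mdist (z l) (z m) by exact: mdist_ge0.
rewrite -ge0_integral_sum//; last 2 first.
- move=> l; apply/measurable_EFinP; apply: measurable_funM => //.
  exact: measurable_mdistr.
- by move=> l t _; rewrite lee_fin mulr_ge0// mdist_ge0.
apply: ge0_le_integral => //.
- move=> t _; rewrite lee_fin; apply: sumr_ge0 => l _; apply: sumr_ge0 => m _.
  by rewrite mulr_ge0// relay_at_ge0.
- apply/measurable_EFinP; apply: measurable_sum => l.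
  exact: measurable_sum.
- apply: emeasurable_sum => l; apply/measurable_EFinP.
  by apply: measurable_funM => //; exact: measurable_mdistr.
- move=> t _; rewrite sumEFin lee_fin; apply: relay_cost => //.
  + by move=> k; exact: mdist_ge0.
  + by move=> l; exact: mdistxx.
  + move=> l m; apply: le_trans (metric_triangle _ t _) _.
    by rewrite (metric_sym (z l)).
Qed.

End MeanRelay.

(** * Compactness of systems of inequalities *)

(** Approximate solutions in the compact cube have a cluster point, and each
    inequality, being closed, passes to it. *)
Lemma compact_approx_le (R : realType) (I : eqType)
    (F : set ((I -> R) -> R)) :
  (forall f, F f -> continuous (f : prod_topology (fun _ : I => R) -> R)) ->
  (forall e, 0 < e -> exists u : I -> R,
     (forall i, 0 <= u i <= 1) /\ forall f, F f -> f u <= e) ->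
  exists u : I -> R, (forall i, 0 <= u i <= 1) /\ forall f, F f -> f u <= 0.
Proof.
move=> Fc Fe; pose U := prod_topology (fun _ : I => R).
pose K : set U := [set u | forall i, (`[0, 1]%classic : set R) (u i)].
have cK : compact K.
  exact: (@tychonoff I (fun=> R) _ (fun=> @segment_compact R 0 1)).
have /choice[w wP] (k : nat) : exists u : U,
    (forall i, 0 <= u i <= 1) /\ forall f, F f -> f u <= k.+1%:R^-1.
  by apply: Fe; rewrite invr_gt0.
have [|u [Ku uw]] := cK (w @ \oo) _.
  exists 0%N => // k _ i /=; rewrite in_itv/=; exact: (wP k).1.
exists u; split=> [i|f Ff]; first by have := Ku i; rewrite /= in_itv.
apply/ler_addgt0Pr => e e0; rewrite add0r.
have fcl : closed [set v : U | f v <= e].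
  exact: ((@continuous_closedP U R f).1 (Fc _ Ff) _ (@closed_le R e)).
have we : \forall k \near \oo, f (w k) <= e.
  near=> k; apply: (le_trans ((wP k).2 _ Ff)); apply: ltW.
  by near: k; exact: (near_infty_natSinv_lt (PosNum e0)).
by apply: fcl; move: uw; rewrite clusterE; apply.
Unshelve. all: by end_near. Qed.

Section RealContinuity.
Context {R : realType} {T : topologicalType}.
Implicit Types f g : T -> R.

Lemma sum_continuous (I : Type) (r : seq I) (f : I -> T -> R) :
  (forall i, continuous (f i)) -> continuous (fun t => \sum_(i <- r) f i t).
Proof.
move=> cf t; elim: r => [|i r IH].
  by under eq_fun do rewrite big_nil; exact: cvg_cst.
under eq_fun do rewrite big_cons.
by apply: cvgD => //; exact: cf.
Qed.

Lemma sub_continuous f g :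
  continuous f -> continuous g -> continuous (fun t => f t - g t).
Proof. by move=> cf cg t; apply: cvgB; [exact: cf|exact: cg]. Qed.

Lemma subr_continuous f c : continuous f -> continuous (fun t => f t - c).
Proof. by move=> cf; apply: sub_continuous => // t; exact: cvg_cst. Qed.

Lemma mulr_continuous f c : continuous f -> continuous (fun t => f t * c).
Proof. by move=> cf t; apply: cvgMl; exact: cf. Qed.

Lemma mull_continuous f c : continuous f -> continuous (fun t => c * f t).
Proof. by move=> cf t; apply: cvgMr; exact: cf. Qed.

Lemma normr_continuous f : continuous f -> continuous (fun t => `|f t|).
Proof. by move=> cf t; apply: cvg_norm; exact: cf. Qed.

End RealContinuity.

(** * From pairs in the Wasserstein balls to feasible plans *)

Section Plans.
Context {R : realType} {X : pmetricType R} {n : nat} (z : 'I_n -> X).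
Context (w : bool -> 'cV[R]_n) (w0 : forall k l, 0 <= w k l ord0)
  (w1 : forall k, \sum_l w k l ord0 = 1).

(** In families indexed by [bool], [true] is the side of [mu] and [false] the
    side of [nu]. *)
Definition plan_rows (H : bool -> 'I_n -> 'I_n -> R) :=
  forall k l, \sum_m H k l m = w k l ord0.

Definition plan_cost (H : bool -> 'I_n -> 'I_n -> R) k :=
  \sum_l \sum_m H k l m * mdist (z l) (z m).

(** The lower bound of [KL_dual_le] for the masses that the two plans bring to
    the sites. *)
Definition dual_value (H : bool -> 'I_n -> 'I_n -> R) (s : 'I_n -> R) :=
  \sum_m ((s m + 1) * (\sum_l H false l m) - expR (s m) * (\sum_l H true l m)).

(** Both plans relay mass according to the laws of the origins that the two
    couplings give, with the roles of the two sides exchanged. By [relay_col],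
    the masses they bring to the sites come from the same kernel, so that
    [KL_dual_le] applies. *)
Lemma coupling_pair_plan (P : bool -> probability (borelType X) R)
    (G : bool -> probability (borelType (X * X)%type) R) :
  (forall k, couplings (P k) (atomic (w k) z) (G k)) ->
  exists H, [/\ forall k l m, 0 <= H k l m, plan_rows H,
    forall k, ((plan_cost H k)%:E <= \int[G k]_u (mdist u.1 u.2)%:E)%E &
    forall s, ((dual_value H s)%:E <= KL (P false) (P true))%E].
Proof.
move=> PG.
have /choice[a aP] k := coupling_density (w k) z (w0 k) (w1 k) (PG k).
have ma k l : measurable_fun setT (a k l) by have [ma _ _ _ _] := aP k.
have a0 k l t : 0 <= a k l t by have [_ a0 _ _ _] := aP k.
have a1 k t : \sum_l a k l t = 1 by have [_ _ a1 _ _] := aP k.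
exists (fun k => mean_relay z (P k) (a k) (a (~~ k))); split.
- by move=> k l m; exact: mean_relay_ge0.
- move=> k l; rewrite mean_relay_row//.
  by have [_ _ _ -> _] := aP k.
- move=> k; have [_ _ _ _] := aP k; apply: le_trans.
  exact: mean_relay_cost.
move=> s; pose K m t := \sum_l relay_at z (a true) (a false) t l m.
apply: (@le_trans _ _ (\sum_m ((s m + 1) * (\int[P false]_t K m t) -
    expR (s m) * (\int[P true]_t K m t)))%:E); last first.
  apply: KL_dual_le.
  - by move=> m; apply: measurable_sum => l; exact: measurable_relay_at.
  - by move=> m t; apply: sumr_ge0 => l _; exact: relay_at_ge0.
  - move=> t; rewrite exchange_big/= -(a1 true t); apply: eq_bigr => l _.
    exact: relay_at_row.
rewrite lee_fin le_eqVlt; apply/orP; left; apply/eqP.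
apply: eq_bigr => m _; rewrite !mean_relay_col//.
congr (_ * _ - _); apply: eq_Rintegral => t _.
exact: relay_col.
Qed.

Lemma wasserstein_ball_near k (P : probability (borelType X) R) (r e : R) :
  0 < e -> wasserstein_ball (atomic (w k) z) r P ->
  exists2 G, couplings P (atomic (w k) z) G &
    (\int[G]_u (mdist u.1 u.2)%:E <= (r + e)%:E)%E.
Proof.
move=> e0 Pr; have : (wasserstein P (atomic (w k) z) < (r + e)%:E)%E.
  by apply: le_lt_trans Pr _; rewrite lte_fin ltrDl.
by move=> /ereal_inf_lt[_ [G cG <-] /ltW]; exists G.
Qed.

(** The Wasserstein distance is an infimum, so that couplings only give plans
    whose costs exceed the radii by an arbitrarily small [e]. All the
    conditions on a pair of plans, including the bound on the dual values, are
    closed, and compactness removes [e]. *)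
Lemma ball_pair_plan (P : bool -> probability (borelType X) R)
    (r : bool -> R) (V : R) :
  (forall k, wasserstein_ball (atomic (w k) z) (r k) (P k)) ->
  (KL (P false) (P true) <= V%:E)%E ->
  exists H, [/\ forall k l m, 0 <= H k l m, plan_rows H,
    forall k, plan_cost H k <= r k & forall s, dual_value H s <= V].
Proof.
move=> Pr PV; pose I := (bool * 'I_n * 'I_n)%type.
pose U : topologicalType := prod_topology (fun _ : I => R).
pose unfold (u : I -> R) k l m := u (k, l, m).
pose F : set ((I -> R) -> R) := [set f |
  [\/ exists k l, f = fun u => `|\sum_m unfold u k l m - w k l ord0|,
      exists k, f = fun u => plan_cost (unfold u) k - r k |
      exists s, f = fun u => dual_value (unfold u) s - V]].
have cu k l m : continuous ((fun u => unfold u k l m) : U -> R).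
  exact: (@proj_continuous I (fun=> R) (k, l, m)).
have crow k l : continuous ((fun u => \sum_m unfold u k l m) : U -> R).
  exact: (@sum_continuous R U _ _ (fun m u => unfold u k l m)).
have ccol k m : continuous ((fun u => \sum_l unfold u k l m) : U -> R).
  exact: (@sum_continuous R U _ _ (fun l u => unfold u k l m)).
have ccost k : continuous ((fun u => plan_cost (unfold u) k) : U -> R).
  apply: (@sum_continuous R U _ _ (fun l u => \sum_m _)) => l.
  apply: (@sum_continuous R U _ _ (fun m u => _)) => m.
  exact: mulr_continuous.
have cdual s : continuous ((fun u => dual_value (unfold u) s) : U -> R).
  apply: (@sum_continuous R U _ _ (fun m u => _)) => m.
  by apply: (@sub_continuous R U); exact: (@mull_continuous R U).
have [f|e e0|u [u01 uF]] := @compact_approx_le R I F.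
- move=> [[k [l ->]]|[k ->]|[s ->]].
  + by apply: (@normr_continuous R U); exact: (@subr_continuous R U).
  + exact: (@subr_continuous R U).
  + exact: (@subr_continuous R U).
- have /choice[G GP] k : exists G, couplings (P k) (atomic (w k) z) G /\
      (\int[G]_u (mdist u.1 u.2)%:E <= (r k + e)%:E)%E.
    by have [G] := wasserstein_ball_near k (P k) (r k) e e0 (Pr k); exists G.
  have [H [H0 Hw Hc Hd]] := coupling_pair_plan P G (fun k => (GP k).1).
  exists (fun i => H i.1.1 i.1.2 i.2); split.
    move=> [[k l] m]/=; rewrite H0/= -(w1 k) (bigD1 l)//= -Hw (bigD1 m)//=.
    by rewrite -addrA lerDl addr_ge0// sumr_ge0.
  move=> f [[k [l ->]]|[k ->]|[s ->]].
  + by rewrite /unfold/= Hw subrr normr0 ltW.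
  + by rewrite lerBlDl -lee_fin; apply: le_trans (Hc k) (GP k).2.
  + rewrite lerBlDr -lee_fin (le_trans (Hd s))// (le_trans PV)// lee_fin.
    by rewrite lerDr ltW.
exists (unfold u); split.
- by move=> k l m; have /andP[] := u01 (k, l, m).
- move=> k l; apply/eqP; rewrite -subr_eq0 -normr_le0.
  by apply: (uF (fun u => `|\sum_m unfold u k l m - w k l ord0|));
    constructor 1; exists k, l.
- move=> k; rewrite -subr_le0.
  by apply: (uF (fun u => plan_cost (unfold u) k - r k));
    constructor 2; exists k.
- move=> s; rewrite -subr_le0.
  by apply: (uF (fun u => dual_value (unfold u) s - V));
    constructor 3; exists s.
Qed.

End Plans.

(** * From feasible plans to the Wasserstein balls *)

Section AtomicBall.
Context {R : realType} {X : pmetricType R} {n : nat} (z : 'I_n -> X).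
Local Open Scope ereal_scope.

Lemma mulmx_ones (G : 'M[R]_n) (p : 'cV[R]_n) :
  (G *m const_mx 1 = p)%R -> forall l, (\sum_m G l m = p l ord0)%R.
Proof.
by move=> <- l; rewrite mxE; apply: eq_bigr => m _; rewrite mxE mulr1.
Qed.

Lemma sum_transport (r : R) (p0 p : 'cV[R]_n) G :
  transport_constraints z r p0 p G ->
  (\sum_l p l ord0 = \sum_l p0 l ord0)%R.
Proof.
move=> [_ _ _ /mulmx_ones Grow /mulmx_ones Gcol].
under eq_bigr do rewrite -Gcol; under [RHS]eq_bigr do rewrite -Grow.
rewrite exchange_big/=; apply: eq_bigr => l _.
by apply: eq_bigr => m _; rewrite mxE.
Qed.

(** The matrix [G], read as a law on pairs of sites, is a coupling of the two
    atomic measures. *)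
Lemma transport_wasserstein_ball (r : R) (p0 p : 'cV[R]_n) G
    (P : probability (borelType X) R) :
  transport_constraints z r p0 p G -> (\sum_l p0 l ord0 = 1)%R ->
  P = atomic p z :> (set (borelType X) -> \bar R) ->
  wasserstein_ball (atomic p0 z) r P.
Proof.
move=> [p_ge0 G_ge0 Gr /mulmx_ones Grow /mulmx_ones Gcol] p01 Pp.
pose q (i : 'I_n * 'I_n) := G i.1 i.2.
(* the rows of [G] index the second marginal of the coupling *)
pose f (i : 'I_n * 'I_n) : borelType (X * X)%type := (z i.2, z i.1).
have q_ge0 i : (0 <= q i)%R by exact: G_ge0.
have q1 : (\sum_i q i = 1)%R.
  rewrite -p01 -(pair_bigA _ (fun l m => G l m))/=.
  by apply: eq_bigr => l _; exact: Grow.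
have [Gam GamE] := finite_atomic_probability _ q f q_ge0 q1.
apply: (@le_trans _ _ (\int[Gam]_u (mdist u.1 u.2)%:E)).
  apply: ereal_inf_lbound; exists Gam => //; split=> [A mA|B mB].
  - rewrite GamE Pp /atomic -(pair_bigA _ (fun l m =>
      (G l m)%:E * \d_(f (l, m)) (A `*` setT)))/= exchange_big/=.
    apply: eq_bigr => m _; rewrite -Gcol -sumEFin ge0_sume_distrl; last first.
      by move=> l _; rewrite lee_fin mxE.
    apply: eq_bigr => l _; rewrite mxE !diracE; congr (_ * (_ %:R)%:E).
    congr nat_of_bool.
    by apply/idP/idP => [/set_mem[]|/set_mem] *; exact/mem_set.
  - rewrite GamE /atomic -(pair_bigA _ (fun l m =>
      (G l m)%:E * \d_(f (l, m)) (setT `*` B)))/=.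
    apply: eq_bigr => l _; rewrite -Grow -sumEFin ge0_sume_distrl; last first.
      by move=> m _; rewrite lee_fin.
    apply: eq_bigr => m _; rewrite !diracE; congr (_ * (_ %:R)%:E).
    congr nat_of_bool.
    by apply/idP/idP => [/set_mem[]|/set_mem] *; exact/mem_set.
rewrite (integral_finite_atomic _ q f q_ge0 Gam GamE);
  last exact: measurable_mdist.
rewrite lee_fin -(pair_bigA _ (fun l m => G l m * mdist (z m) (z l))%R)/=.
apply: le_trans Gr; apply: ler_sum => l _; apply: ler_sum => m _.
by rewrite metric_sym.
Qed.

End AtomicBall.

Section Empirical.
Context {R : realType} {X : pmetricType R} {n1 n2 : nat}.
Context (x : 'I_n1 -> X) (y : 'I_n2 -> X).
Local Open Scope ereal_scope.

Lemma merge_samples_lshift i : merge_samples x y (lshift n2 i) = x i.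
Proof. by rewrite /merge_samples (unsplitK (inl i)). Qed.

Lemma merge_samples_rshift j : merge_samples x y (rshift n1 j) = y j.
Proof. by rewrite /merge_samples (unsplitK (inr j)). Qed.

Lemma empirical_mu0_vec :
  empirical x = atomic (mu0_vec n1 n2) (merge_samples x y).
Proof.
apply/funext => A; rewrite /empirical /atomic big_split_ord/= [X in _ + X]big1.
  rewrite adde0 ge0_sume_distrr//; apply: eq_bigr => i _.
  by rewrite col_mxEu mxE merge_samples_lshift.
by move=> j _; rewrite col_mxEd mxE mul0e.
Qed.

Lemma empirical_nu0_vec :
  empirical y = atomic (nu0_vec n1 n2) (merge_samples x y).
Proof.
apply/funext => A; rewrite /empirical /atomic big_split_ord/= [X in X + _]big1.
  rewrite add0e ge0_sume_distrr//; apply: eq_bigr => i _.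
  by rewrite col_mxEd mxE merge_samples_rshift.
by move=> j _; rewrite col_mxEu mxE mul0e.
Qed.

Lemma mu0_vec_ge0 l : (0 <= mu0_vec n1 n2 l ord0 :> R)%R.
Proof.
by rewrite -[l]splitK; case: (fintype.split l) => i /=;
  rewrite ?col_mxEu ?col_mxEd mxE// invr_ge0.
Qed.

Lemma nu0_vec_ge0 l : (0 <= nu0_vec n1 n2 l ord0 :> R)%R.
Proof.
by rewrite -[l]splitK; case: (fintype.split l) => i /=;
  rewrite ?col_mxEu ?col_mxEd mxE// invr_ge0.
Qed.

Lemma sum_mu0_vec : (0 < n1)%N -> (\sum_l mu0_vec n1 n2 l ord0 = 1 :> R)%R.
Proof.
move=> n1_gt0; rewrite big_split_ord/= [X in (_ + X)%R]big1 ?addr0.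
  under eq_bigr do rewrite col_mxEu mxE.
  by rewrite sumr_const card_ord -[LHS]mulr_natr mulVf// pnatr_eq0 -lt0n.
by move=> j _; rewrite col_mxEd mxE.
Qed.

Lemma sum_nu0_vec : (0 < n2)%N -> (\sum_l nu0_vec n1 n2 l ord0 = 1 :> R)%R.
Proof.
move=> n2_gt0; rewrite big_split_ord/= [X in (X + _)%R]big1 ?add0r.
  under eq_bigr do rewrite col_mxEd mxE.
  by rewrite sumr_const card_ord -[LHS]mulr_natr mulVf// pnatr_eq0 -lt0n.
by move=> j _; rewrite col_mxEu mxE.
Qed.

End Empirical.

(** * Least favorable distributions *)

Theorem theorem1 (R : realType) (X : pmetricType R) (n1 n2 : nat)
    (n1_gt0 : (0 < n1)%N) (n2_gt0 : (0 < n2)%N)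
    (x : 'I_n1 -> X) (y : 'I_n2 -> X)
    (r1 r2 : R) (r1_ge0 : 0 <= r1) (r2_ge0 : 0 <= r2)
    (p1 p2 : 'cV[R]_(n1 + n2)) (G1 G2 : 'M[R]_(n1 + n2)) :
  optimal x y r1 r2 p1 p2 G1 G2 ->
  exists mu nu : probability (borelType X) R,
    [/\ mu = atomic p1 (merge_samples x y) :> (set (borelType X) -> \bar R),
        nu = atomic p2 (merge_samples x y) :> (set (borelType X) -> \bar R) &
        least_favorable (wasserstein_ball (empirical x) r1)
                        (wasserstein_ball (empirical y) r2) mu nu].
Proof.
move=> [[T1 T2] opt]; set z := merge_samples x y.
pose w k : 'cV[R]_(n1 + n2) := if k then mu0_vec n1 n2 else nu0_vec n1 n2.
have w0 k l : 0 <= w k l ord0.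
  by case: k; [exact: mu0_vec_ge0|exact: nu0_vec_ge0].
have w1 k : \sum_l w k l ord0 = 1.
  by case: k; [exact: sum_mu0_vec|exact: sum_nu0_vec].
have [p1_ge0 _ _ _ _] := T1; have [p2_ge0 _ _ _ _] := T2.
have p1_1 : \sum_l p1 l ord0 = 1.
  by rewrite (sum_transport _ _ _ _ _ T1) (w1 true).
have p2_1 : \sum_l p2 l ord0 = 1.
  by rewrite (sum_transport _ _ _ _ _ T2) (w1 false).
have [mu muE] := @finite_atomic_probability _ (borelType X) R _ _ z p1_ge0 p1_1.
have [nu nuE] := @finite_atomic_probability _ (borelType X) R _ _ z p2_ge0 p2_1.
have mu_p1 : mu = atomic p1 z :> (set (borelType X) -> \bar R) by exact/funext.
have nu_p2 : nu = atomic p2 z :> (set (borelType X) -> \bar R) by exact/funext.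
exists mu, nu; split=> //.
rewrite (empirical_mu0_vec x y) (empirical_nu0_vec x y).
split.
- exact: (transport_wasserstein_ball _ _ _ _ _ _ T1 (w1 true)).
- exact: (transport_wasserstein_ball _ _ _ _ _ _ T2 (w1 false)).
move=> mu' nu' mu'P nu'P.
have : (0 <= KL nu' mu')%E by exact: KL_ge0.
case KLV : (KL nu' mu') => [V||] // _; last by rewrite leey.
pose P k : probability (borelType X) R := if k then mu' else nu'.
have [||H [H0 Hrow Hcost Hdual]] :=
    ball_pair_plan z w w0 w1 P (fun k : bool => if k then r1 else r2) V.
- by case.
- by rewrite KLV.
pose Hmx k : 'M[R]_(n1 + n2) := \matrix_(l, m) H k l m.
pose q k : 'cV[R]_(n1 + n2) := (Hmx k)^T *m const_mx 1.
have qE k m : q k m ord0 = \sum_l H k l m.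
  by rewrite mxE; apply: eq_bigr => l _; rewrite !mxE mulr1.
have q0 k m : 0 <= q k m ord0 by rewrite qE sumr_ge0.
have feas k :
    transport_constraints z (if k then r1 else r2) (w k) (q k) (Hmx k).
  split=> // [l m||]; first by rewrite mxE.
    apply: le_trans (Hcost k); apply: ler_sum => l _; apply: ler_sum => m _.
    by rewrite mxE.
  apply/matrixP => l j; rewrite (ord1 j) -Hrow mxE; apply: eq_bigr => m _.
  by rewrite !mxE mulr1.
(* the plans obtained from [mu'] and [nu'] are feasible for the program *)
apply: (@le_trans _ _ (objective p1 p2)).
  exact: (@KL_finite_atomic_le _ (borelType X) R _ _ _ z mu nu
    p1_ge0 p2_ge0 muE nuE).
apply: (@le_trans _ _ (objective (q true) (q false))).
  apply: (opt _ _ (Hmx true) (Hmx false)).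
  by split; [exact: (feas true)|exact: (feas false)].
apply: objective_le_dual => // s; rewrite lee_fin.
by under eq_bigr do rewrite !qE; exact: Hdual.
Qed.
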